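(* Let $A\in\mathbb{R}^{n\times n}$ be symmetric positive definite, $b,x_0\in\mathbb{R}^n$, $x^\ast=A^{-1}b$, $k\in\{1,\dots,n-1\}$ and $\theta\in[\lambda_{k+1},\lambda_k]$. Let $(x_\ell)_{\ell\in\{1,\dots,n\}}$ be the sequence generated by the conjugate gradient method, and $(\hat x_\ell(\theta))_{\ell\in\{1,\dots,n\}}$ the sequence generated by the preconditioned conjugate gradient method with preconditioner $F_\theta$, when solving $Ax=b$, both started from the same initial guess $\hat x_0(\theta)=x_0$. Then, for all $\ell=1,\dots,n$, $$\|x^\ast-\hat x_\ell(\theta)\|_A\le\|x^\ast-x_\ell\|_A.$$
   Context: Notation: $A=S\Lambda S^\top$ is the spectral decomposition, with $\Lambda=\mathrm{diag}(\lambda_1,\dots,\lambda_n)$, $\lambda_1\ge\cdots\ge\lambda_n>0$, and $S=[s_1\ \cdots\ s_n]$ orthogonal. $\|x\|_A=\sqrt{x^\top Ax}$. Scaled spectral preconditioner: $F_\theta=I_n+\sum_{i=1}^k\left(\frac{\theta}{\lambda_i}-1\right)s_is_i^\top$. Preconditioned conjugate gradient method (PCG) with preconditioner $F$ and initial guess $\hat x_0=x_0$, in exact arithmetic: $\hat r_0=b-A\hat x_0$, $z_0=F\hat r_0$, $\hat\rho_0=\hat r_0^\top z_0$, $\hat p_0=z_0$, and for $\ell=0,1,\dots$: $\hat q_\ell=A\hat p_\ell$, $\hat\alpha_\ell=\hat\rho_\ell/(\hat q_\ell^\top\hat p_\ell)$, $\hat x_{\ell+1}=\hat x_\ell+\hat\alpha_\ell\hat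 p_\ell$, $\hat r_{\ell+1}=\hat r_\ell-\hat\alpha_\ell\hat q_\ell$, $z_{\ell+1}=F\hat r_{\ell+1}$, $\hat\rho_{\ell+1}=\hat r_{\ell+1}^\top z_{\ell+1}$, $\hat\beta_{\ell+1}=\hat\rho_{\ell+1}/\hat\rho_\ell$, $\hat p_{\ell+1}=z_{\ell+1}+\hat\beta_{\ell+1}\hat p_\ell$. The conjugate gradient method (CG) is the case $F=I_n$. If the residual at step $\ell$ is zero the method has terminated with the exact solution $x^\ast$, and later iterates are taken equal to $x^\ast$. *)

(* Defs.v *)
From HB Require Import structures.
From mathcomp Require Import all_boot all_order all_algebra.
Set Implicit Arguments.
Unset Strict Implicit.
Unset Printing Implicit Defensive.
Import Order.TTheory GRing.Theory Num.Theory.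
Local Open Scope ring_scope.

(* Vectors are columns, indices start at 0: the mathematical lambda_i and s_i *)
(* (1 <= i <= n) are [lam 0 j] and [col j S] for the j : 'I_n of value i - 1.  *)

Section Definitions.
Variables (R : rcfType) (n : nat).
Implicit Types (A S F : 'M[R]_n) (lam : 'rV[R]_n) (u v b x : 'cV[R]_n).

Definition vdot u v : R := (u^T *m v) 0 0.

Definition energy_norm A x : R := Num.sqrt (vdot x (A *m x)).

Definition spd A : Prop :=
  A^T = A /\ (forall x, x != 0 -> 0 < vdot x (A *m x)).

Definition spectral_decomposition A S lam : Prop :=
  [/\ S^T *m S = 1%:M,
      A = S *m diag_mx lam *m S^T,
      (forall i j : 'I_n, (i <= j)%N -> lam 0 j <= lam 0 i)
    & (forall i : 'I_n, 0 < lam 0 i)].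

Definition scaled_spectral_prec S lam (k : nat) (theta : R) : 'M[R]_n :=
  1%:M + \sum_(i < n | (i < k)%N)
           (theta / lam 0 i - 1) *: (col i S *m (col i S)^T).

Record pcg_state := PCGState {
  pcg_x : 'cV[R]_n;
  pcg_r : 'cV[R]_n;
  pcg_p : 'cV[R]_n;
  pcg_rho : R }.

Definition pcg_init A F b x0 : pcg_state :=
  let r := b - A *m x0 in
  let z := F *m r in
  PCGState x0 r z (vdot r z).

(* Since [pcg_r] is always [b - A *m pcg_x], a zero residual means that [pcg_x] *)
(* is the exact solution; the state is then frozen.                            *)
Definition pcg_step A F (s : pcg_state) : pcg_state :=
  let: PCGState x r p rho := s in
  if r == 0 then s else
  let q := A *m p in
  let alpha := rho / vdot q p in
  let x' := x + alpha *: p in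
  let r' := r - alpha *: q in
  let z' := F *m r' in
  let rho' := vdot r' z' in
  let beta := rho' / rho in
  PCGState x' r' (z' + beta *: p) rho'.

Definition pcg A F b x0 (l : nat) : 'cV[R]_n :=
  pcg_x (iter l (pcg_step A F) (pcg_init A F b x0)).

Definition cg A b x0 (l : nat) : 'cV[R]_n := pcg A 1%:M b x0 l.

End Definitions.

Lemma ltn_pred_trans (k n : nat) : (k < n)%N -> (k.-1 < n)%N.
Proof. exact: leq_ltn_trans (leq_pred k). Qed.

(* Main.v *)
Require Import Defs.
From HB Require Import structures.
From mathcomp Require Import all_boot all_order all_algebra.
From mathcomp Require Import ring lra polyrcf.
Set Implicit Arguments.
Unset Strict Implicit.
Unset Printing Implicit Defensive.
Import Order.TTheory GRing.Theory Num.Theory.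
Local Open Scope ring_scope.

(** Write e_0 for the initial error and eta_i for its coordinates in the
    eigenbasis of A.  PCG with a preconditioner that is diagonal in that basis,
    with entries f_i > 0, keeps its error in the form (r(mu_i) eta_i)_i, where
    mu_i = f_i lambda_i and r is a polynomial of degree at most l with
    r(0) = 1, and among all such polynomials its choice minimizes the energy
    norm ([pcg_optimal]).  For CG, mu_i = lambda_i; for the scaled spectral
    preconditioner, mu_i = theta for the k leading indices and mu_i = lambda_i
    for the others.  Hence it suffices to turn the polynomial r of CG into a
    polynomial q of no larger degree with q(0) = 1, such that
    |q(theta)| <= |r(x)| for every x >= theta and |q(x)| <= |r(x)| for every x
    in ]0, theta] ([pcg_polys_competitor]).

    If r has a root z >= theta, replace its factor 1 - x/z by 1 - x/theta: the
    new polynomial vanishes at theta, and 0 <= 1 - x/theta <= 1 - x/z on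
    ]0, theta].  Otherwise q = r is a correct choice as soon as |r| is
    nondecreasing on [theta, +oo[.  This would be clear from the fact that r
    has only real roots, but the coupled recurrence of residual and direction
    polynomials gives it directly ([pcg_polys_root_or_growth]): up to signs,
    residual and direction polynomials s, t evolve by
      s' = alpha x t - s,   t' = s' - beta t    (alpha > 0, beta >= 0),
    and u = x t / s satisfies s'/s = alpha u - 1 and
    u' = x - beta u / (alpha u - 1).  As long as every s is positive on
    [theta, +oo[, an induction shows that s and u are nondecreasing there;
    once some s has a root beyond theta, all later ones do.

    The optimality of PCG is the usual orthogonality argument, carried out on
    polynomials for the discrete bilinear form with nodes mu_i and weights
    f_i (lambda_i eta_i)^2 ([conjugate_pair_step]). *)

(** * The recurrence of residual and direction polynomials *)

(** The pairs of polynomials that m steps of PCG can produce, keeping of the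
    coefficients only their signs: these alone yield the alternative between a
    root at or beyond theta and growth on [theta, +oo[.  The case beta = 0 is the step that reaches the
    exact solution. *)
Inductive pcg_polys (R : rcfType) : nat -> {poly R} -> {poly R} -> Prop :=
| PcgPolys0 : pcg_polys 0 1 1
| PcgPolysS m r p (alpha beta : R) :
    pcg_polys m r p -> 0 < alpha -> 0 <= beta ->
    pcg_polys m.+1 (r - alpha *: ('X * p))
              (r - alpha *: ('X * p) + beta *: p).

(** * Roots and growth of the residual polynomial beyond theta *)

Section RootLocation.
Variable R : rcfType.
Implicit Types (r p s t q : {poly R}) (theta x y z alpha beta : R).

(** A polynomial without a root on [a, +oo[ has there the sign of its leading
    coefficient; otherwise split off a root and start again from it, until the
    cofactor is positive. *)
Lemma pos_or_last_root q a : 0 < lead_coef q ->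
  (forall x, a <= x -> 0 < q.[x]) \/
  (exists z, [/\ a <= z, q.[z] = 0 & forall x, z <= x -> 0 <= q.[x]]).
Proof.
have [d] := ubnP (size q); elim: d q a => // d IHd q a /ltnSE-le_q_d lc_q.
have q_neq0: q != 0 by rewrite -lead_coef_eq0 gt_eqF.
have [/hasP[z _ /andP[le_a_z /factor_theorem[g Dq]]] | no_root] :=
  boolP (has (fun z => (a <= z) && root q z) (rootsR q)); last first.
  left=> x le_a_x; rewrite -sgr_gt0.
  have noroot_q: {in `[a, +oo[, forall y, ~~ root q y}.
    move=> y; rewrite in_itv andbT /= => le_a_y.
    apply: contra no_root => root_y; apply/hasP; exists y; last exact/andP.
    by have := roots_on_rootsR q_neq0 y; rewrite root_y => <-.
  rewrite (sgp_pinftyP noroot_q) ?in_itv ?andbT //.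
  by rewrite /sgp_pinfty gtr0_sg.
have g_neq0: g != 0 by apply: contra_neq q_neq0 => g0; rewrite Dq g0 mul0r.
have lc_g: 0 < lead_coef g.
  by move: lc_q; rewrite Dq lead_coef_Mmonic ?monicXsubC.
have lt_g_d: (size g < d)%N.
  move: le_q_d; rewrite Dq size_Mmonic ?monicXsubC // size_XsubC addn2 /=.
  by [].
have Eq x: q.[x] = g.[x] * (x - z) by rewrite Dq !hornerE.
right; have [g_pos | [z' [le_z_z' g_z' g_pos]]] := IHd g z lt_g_d lc_g.
  exists z; split=> // [|x le_z_x]; first by rewrite Eq subrr mulr0.
  by rewrite Eq mulr_ge0 ?subr_ge0 // ltW ?g_pos.
exists z'; split=> [||x le_z'_x]; first exact: le_trans le_z_z'.
  by rewrite Eq g_z' mul0r.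
by rewrite Eq mulr_ge0 ?g_pos // subr_ge0 (le_trans le_z_z').
Qed.

(** The quotient x t(x) / s(x) must be followed along with s, because it is what
    decides the growth of the next s. *)
Definition rising theta s t :=
  (forall x, theta <= x -> 0 < s.[x]) /\
  (forall x y, theta <= x -> x <= y ->
     s.[x] <= s.[y] /\ x * t.[x] / s.[x] <= y * t.[y] / s.[y]).

(** All inequalities are weak, so that the step with beta = 0 preserves them.
    The condition on t(z) makes the next s nonpositive at z, which forces its
    last root to lie at or beyond z. *)
Definition crossed theta s t :=
  exists z, [/\ theta <= z, s.[z] = 0, t.[z] <= 0
              & forall x, z <= x -> 0 <= s.[x]].

(** With u = x t / s, the new s is s (alpha u - 1).  Where it stays positive, it
    is a product of positive nondecreasing factors, and the new quotient
    x - beta u / (alpha u - 1) is nondecreasing because v / (alpha v - 1)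
    decreases for alpha v > 1.  Where it fails to, its last root z witnesses
    the crossing: there alpha z t(z) = s(z) >= 0, and the new t is
    - beta t(z) <= 0. *)
Lemma rising_or_crossed_step theta s t alpha beta :
    0 < theta -> 0 < alpha -> 0 <= beta ->
    let s' := alpha *: ('X * t) - s in
    0 < lead_coef s' ->
    rising theta s t \/ crossed theta s t ->
  rising theta s' (s' - beta *: t) \/ crossed theta s' (s' - beta *: t).
Proof.
move=> theta_gt0 alpha_gt0 beta_ge0 s' lc_s'.
have Es' x: s'.[x] = alpha * (x * t.[x]) - s.[x] by rewrite !hornerE.
have Et' x: (s' - beta *: t).[x] = s'.[x] - beta * t.[x] by rewrite !hornerE.
have crossed_at z: theta <= z -> 0 <= s.[z] -> s'.[z] = 0 ->
    (forall x, z <= x -> 0 <= s'.[x]) -> crossed theta s' (s' - beta *: t).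
  move=> le_theta_z sz s'z s'_ge0; exists z; split=> //.
  have z_gt0: 0 < z by apply: lt_le_trans le_theta_z.
  have tz: 0 <= t.[z].
    have: 0 <= alpha * (z * t.[z]) by 
      rewrite -(subrK s.[z] (_ * _)) -Es' s'z add0r.
    by rewrite !pmulr_rge0.
  by rewrite Et' s'z sub0r oppr_le0 mulr_ge0.
case=> [[s_gt0 mono] | [z [le_theta_z sz tz s_ge0]]]; last first.
  right; have z_gt0: 0 < z by apply: lt_le_trans le_theta_z.
  have s'z: s'.[z] <= 0.
    by rewrite Es' sz subr0 !pmulr_rle0.
  have [s'_gt0 | [z' [le_z_z' s'z' s'_ge0]]] := pos_or_last_root z lc_s'.
    by have := s'_gt0 z (lexx z); rewrite ltNge s'z.
  by apply: (crossed_at z') => //; [apply: le_trans le_z_z' | apply: s_ge0].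
have [s'_gt0 | [z [le_theta_z s'z s'_ge0]]] := pos_or_last_root theta lc_s'.
  left; split=> // x y le_theta_x le_xy.
  have le_theta_y := le_trans le_theta_x le_xy.
  have [le_s le_u] := mono x y le_theta_x le_xy.
  set u := fun w => w * t.[w] / s.[w].
  have Eu w: theta <= w -> s'.[w] = s.[w] * (alpha * u w - 1).
    move=> /s_gt0 sw_gt0; rewrite Es' /u; field; exact: lt0r_neq0.
  have u_gt w: theta <= w -> 0 < alpha * u w - 1.
    by move=> le_w; have := s'_gt0 w le_w; rewrite Eu // pmulr_rgt0 ?s_gt0.
  have Eu' w: theta <= w ->
      w * (s' - beta *: t).[w] / s'.[w] = w - beta * (u w / (alpha * u w - 1)).
    move=> le_w; rewrite Et' Eu //.
    have := u_gt w le_w; have := s_gt0 w le_w => sw uw.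
    have w_gt0: 0 < w by apply: lt_le_trans le_w.
    have ->: t.[w] = u w * s.[w] / w by rewrite /u; field; rewrite !lt0r_neq0.
    by field; rewrite !lt0r_neq0.
  rewrite !Eu' // !Eu //; have := u_gt x le_theta_x; have := u_gt y le_theta_y.
  have := s_gt0 x le_theta_x; move: le_u; rewrite -/(u x) -/(u y).
  move: (u x) (u y) le_s => ux uy le_s le_u sx uy_gt ux_gt; split.
    apply: ler_pM => //; [exact: ltW | exact: ltW |].
    by rewrite lerD2r ler_pM2l.
  apply: lerB => //; apply: ler_wpM2l => //.
  (* After clearing denominators the difference of the sides is uy - ux. *)
  rewrite ler_pdivrMr // mulrAC ler_pdivlMr //; nra.
by right; apply: (crossed_at z) => //; apply/ltW/s_gt0.
Qed.

(** The exact degrees make p a valid top element when a polynomial of degree at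
    most m is reduced to lower degree; the sign of the leading
    coefficient of p makes (-1)^(m+1) times the next r positive near +oo. *)
Lemma pcg_polys_size m r p : pcg_polys m r p ->
  [/\ size r = m.+1, size p = m.+1, (size (p - r)%R <= m)%N,
      r.[0] = 1 & 0 < (-1) ^+ m * lead_coef p].
Proof.
elim=> {m r p} [|m r p alpha beta _ [sz_r sz_p _ r0 lc_p] alpha_gt0 beta_ge0].
  by rewrite size_poly1 subrr size_poly0 lead_coef1 hornerE expr0 mulr1; split.
set q := alpha *: ('X * p).
have p_neq0: p != 0 by rewrite -size_poly_eq0 sz_p.
have sz_q: size q = m.+2.
  by rewrite size_scale ?gt_eqF // mulrC size_mulX // sz_p.
have sz_r': size (r - q) = m.+2.
  by rewrite addrC size_polyDl size_polyN sz_q ?sz_r.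
have lt_bp: (size (beta *: p) < size (r - q)%R)%N.
  by rewrite sz_r' ltnS -sz_p size_scale_leq.
split=> //; first by rewrite size_polyDl.
- by rewrite addrAC subrr add0r -sz_p size_scale_leq.
- by rewrite !hornerE /= r0 mulr0 mul0r subr0.
rewrite lead_coefDl // addrC lead_coefDl ?size_polyN ?sz_q ?sz_r //.
rewrite lead_coefN lead_coefZ ['X * _]mulrC lead_coefMX exprS.
by rewrite mulN1r mulrNN mulrCA mulr_gt0.
Qed.

Lemma pcg_polys_rising_or_crossed theta m r p :
  0 < theta -> pcg_polys m r p ->
  rising theta ((-1) ^+ m *: r) ((-1) ^+ m *: p) \/
  crossed theta ((-1) ^+ m *: r) ((-1) ^+ m *: p).
Proof.
move=> theta_gt0.
elim=> {m r p} [|m r p alpha beta pcg_rp IH alpha_gt0 beta_ge0].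
  left; rewrite expr0 !scale1r; split=> [x | x y] le_theta_x; rewrite !hornerE //.
  by move=> le_xy; rewrite !divr1; split; rewrite ?mulr1.
have [sz_r sz_p _ _ lc_p] := pcg_polys_size pcg_rp.
set s := (-1) ^+ m *: r in IH *; set t := (-1) ^+ m *: p in IH *.
have Es: (-1) ^+ m.+1 *: (r - alpha *: ('X * p)) = alpha *: ('X * t) - s.
  rewrite exprS mulN1r scaleNr -scalerN opprB scalerBr.
  by rewrite /t -scalerAr !scalerA [alpha * _]mulrC.
have Et: (-1) ^+ m.+1 *: (r - alpha *: ('X * p) + beta *: p)
         = alpha *: ('X * t) - s - beta *: t.
  by rewrite scalerDr Es exprS mulN1r scaleNr /t !scalerA [beta * _]mulrC.
rewrite Es Et; apply: rising_or_crossed_step => //.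
have t_neq0: t != 0 by rewrite -lead_coef_eq0 lead_coefZ gt_eqF.
rewrite lead_coefDl.
  by rewrite lead_coefZ ['X * _]mulrC lead_coefMX lead_coefZ mulr_gt0.
rewrite size_polyN [ltnRHS]size_scale ?gt_eqF // ['X * _]mulrC size_mulX // /s /t.
by rewrite !size_scale ?signr_eq0 // sz_r sz_p.
Qed.

Lemma pcg_polys_root_or_growth theta m r p :
    0 < theta -> pcg_polys m r p ->
  (exists2 z, theta <= z & root r z) \/
  (forall x, theta <= x -> `|r.[theta]| <= `|r.[x]|).
Proof.
move=> theta_gt0 /(pcg_polys_rising_or_crossed theta_gt0).
case=> [[s_gt0 mono] | [z [le_theta_z rz _ _]]]; [right | left].
  move=> x le_theta_x; have [le_s _] := mono _ _ (lexx theta) le_theta_x.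
  have absE y: theta <= y -> `|r.[y]| = ((-1) ^+ m *: r).[y].
    move=> /s_gt0/gtr0_norm <-.
    by rewrite hornerZ normrM normrX normrN normr1 expr1n mul1r.
  by rewrite !absE.
exists z => //; apply/eqP; move/eqP: rz.
by rewrite hornerZ mulf_eq0 signr_eq0 => /eqP.
Qed.

(** Moving a root z >= theta down to theta kills the value at theta and shrinks
    the linear factor on ]0, theta]. *)
Lemma pcg_polys_competitor theta m r p :
    0 < theta -> pcg_polys m r p ->
  exists q : {poly R}, [/\ (size q <= m.+1)%N, q.[0] = 1,
    forall x, theta <= x -> `|q.[theta]| <= `|r.[x]|
    & forall x, 0 < x <= theta -> `|q.[x]| <= `|r.[x]|].
Proof.
move=> theta_gt0 pcg_rp; have [sz_r _ _ r0 _] := pcg_polys_size pcg_rp.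
have [[z le_theta_z /factor_theorem[g Dr]] | growth] :=
  pcg_polys_root_or_growth theta_gt0 pcg_rp; last first.
  by exists r; rewrite sz_r; split.
have z_gt0: 0 < z by apply: lt_le_trans le_theta_z.
have g_neq0: g != 0.
  by apply/eqP=> g0; move: sz_r; rewrite Dr g0 mul0r size_poly0.
(* Here - z * g is r divided by the factor 1 - 'X / z. *)
pose q := (- z / theta) *: (g * (theta%:P - 'X)).
have Eq x: q.[x] = - z * g.[x] * (1 - x / theta).
  by rewrite /q !hornerE /=; field; rewrite ?lt0r_neq0.
have Er x: r.[x] = - z * g.[x] * (1 - x / z).
  by rewrite Dr !hornerE; field; rewrite ?lt0r_neq0.
exists q; split=> [||x _|x /andP[x_gt0 le_x_theta]].
- apply: leq_trans (size_scale_leq _ _) _.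
  rewrite -opprB mulrN size_polyN -sz_r Dr.
  by rewrite !size_Mmonic ?monicXsubC ?size_XsubC.
- by rewrite -r0 Er Eq !mul0r.
- by rewrite Eq divff ?gt_eqF // subrr mulr0 normr0.
rewrite Eq Er normrM [leRHS]normrM; apply: ler_wpM2l => //.
have x_theta: x / theta <= 1 by rewrite ler_pdivrMr ?mul1r.
have x_z: x / z <= x / theta by rewrite ler_pM2l // lef_pV2.
by rewrite !ger0_norm ?subr_ge0 ?lerB // (le_trans x_z).
Qed.

End RootLocation.
(** * Orthogonality of the polynomials *)

Section Orthogonality.
Variables (R : rcfType) (n : nat) (w mu : 'I_n -> R).
Implicit Types (r p g h : {poly R}).

Definition node_dot g h : R := \sum_i w i * (g.[mu i] * h.[mu i]).

Lemma node_dotC g h : node_dot g h = node_dot h g.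
Proof. by apply: eq_bigr => i _; rewrite [g.[_] * _]mulrC. Qed.

Lemma node_dot_linear g : scalar (node_dot g).
Proof.
move=> a h k; rewrite /node_dot mulr_sumr -big_split; apply: eq_bigr => i _.
by rewrite !hornerE /=; ring.
Qed.

HB.instance Definition _ g := GRing.isLinear.Build R {poly R} R *%R
  (node_dot g) (node_dot_linear g).

Lemma node_dotX g h : node_dot ('X * g) h = node_dot g ('X * h).
Proof. by apply: eq_bigr => i _; rewrite !hornerE /=; ring. Qed.

(** Orthogonality of the residual to, and A-conjugacy of the direction with, the
    Krylov space of the first m steps. *)
Definition conjugate_pair m r p :=
  (forall h, (size h <= m)%N -> node_dot r h = 0) /\
  (forall h, (size h <= m)%N -> node_dot ('X * p) h = 0).

Lemma size_split_top m p h : size p = m.+1 -> (size h <= m.+1)%N ->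
  exists a g, h = a *: p + g /\ (size g <= m)%N.
Proof.
move=> sz_p sz_h; have lc_p: p`_m != 0.
  by rewrite -[m]/(m.+1.-1) -sz_p lead_coef_eq0 -size_poly_eq0 sz_p.
exists (h`_m / p`_m), (h - (h`_m / p`_m) *: p).
split; first by rewrite addrC subrK.
apply/leq_sizeP => j; rewrite leq_eqVlt coefB coefZ => /predU1P[<-|lt_m_j].
  by rewrite divfK // subrr.
by rewrite ![_`_j]nth_default ?mulr0 ?subr0 ?sz_p ?(leq_trans sz_h lt_m_j).
Qed.

(** A test polynomial of degree at most m is a multiple of p plus one of lower
    degree.  On lower degrees both relations follow from the induction
    hypothesis.  On p they are the defining choices of the step length and of
    beta, using <r, p> = <r, r> and 'X * p = (r - r') / alpha. *)
Lemma conjugate_pair_step m r p :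
    pcg_polys m r p -> conjugate_pair m r p ->
    node_dot r r != 0 -> node_dot ('X * p) p != 0 ->
    let r' := r - (node_dot r r / node_dot ('X * p) p) *: ('X * p) in
  conjugate_pair m.+1 r' (r' + (node_dot r' r' / node_dot r r) *: p).
Proof.
move=> /pcg_polys_size[sz_r sz_p sz_pr _ _] [orth_r conj_p] rr_neq0 pp_neq0.
set alpha := _ / _ => r'; set beta := _ / _.
have alpha_neq0: alpha != 0 by rewrite mulf_neq0 ?invr_eq0.
have dot_r' h : node_dot h r' = node_dot h r - alpha * node_dot h ('X * p).
  by rewrite linearB linearZ.
have r'p: node_dot r' p = 0.
  rewrite node_dotC dot_r' ![node_dot p _]node_dotC.
  rewrite -{1}(subrK r p) linearD /= orth_r // add0r /alpha.
  by rewrite divfK // subrr.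
have orth_r' h : (size h <= m.+1)%N -> node_dot r' h = 0.
  case/(size_split_top sz_p) => a [g [-> sz_g]].
  rewrite linearD linearZ /= r'p mulr0 add0r node_dotC dot_r'.
  by rewrite !(node_dotC g) orth_r // conj_p // mulr0 subr0.
split=> // h; case/(size_split_top sz_p) => a [g [-> sz_g]].
have Exp: 'X * p = alpha^-1 *: (r - r').
  by rewrite /r' opprB addrC subrK scalerA mulVf // scale1r.
have Xp' h' : node_dot ('X * (r' + beta *: p)) h'
    = node_dot r' ('X * h') + beta * node_dot ('X * p) h'.
  by rewrite !node_dotX ![node_dot _ ('X * h')]node_dotC linearD linearZ.
rewrite linearD linearZ /= !Xp' (conj_p g) // mulr0 addr0.
rewrite (orth_r' ('X * g)) ?addr0; last first.
  rewrite mulrC (leq_trans (size_polyMleq _ _)) // size_polyX addn2 /=.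
  by rewrite ltnS.
rewrite {1}Exp linearZ linearB /= orth_r' ?sz_r // sub0r.
rewrite /beta /alpha; set c := node_dot _ p; set d := node_dot r' r'.
have -> : (node_dot r r / c)^-1 * - d + d / node_dot r r * c = 0.
  by field; apply/andP; split.
by rewrite mulr0.
Qed.

End Orthogonality.

(** * Coordinates in an orthonormal eigenbasis *)

Section EigenCoordinates.
Variables (R : rcfType) (n : nat) (S : 'M[R]_n).
Hypothesis S_orth : S^T *m S = 1%:M.
Implicit Types (u v : 'cV[R]_n) (d : 'rV[R]_n).

Definition eigen_coord v (i : 'I_n) : R := (S^T *m v) i 0.

Lemma eigen_coordD u v i : eigen_coord (u + v) i = eigen_coord u i + eigen_coord v i.
Proof. by rewrite /eigen_coord mulmxDr mxE. Qed.

Lemma eigen_coordB u v i : eigen_coord (u - v) i = eigen_coord u i - eigen_coord v i.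
Proof. by rewrite /eigen_coord mulmxBr !mxE. Qed.

Lemma eigen_coordZ a v i : eigen_coord (a *: v) i = a * eigen_coord v i.
Proof. by rewrite /eigen_coord -scalemxAr mxE. Qed.

Lemma eigen_coord_diag d v i :
  eigen_coord (S *m diag_mx d *m S^T *m v) i = d 0 i * eigen_coord v i.
Proof. by rewrite /eigen_coord !mulmxA S_orth mul1mx -mulmxA mul_diag_mx mxE. Qed.

Lemma vdot_eigen_coord u v :
  vdot u v = \sum_i eigen_coord u i * eigen_coord v i.
Proof.
have SST : S *m S^T = 1%:M by apply: mulmx1C.
rewrite /vdot -[v in LHS]mul1mx -SST -mulmxA mulmxA -[u^T *m S]trmxK trmx_mul trmxK mxE.
by apply: eq_bigr => i _; rewrite mxE.
Qed.

Lemma eigen_coord_eq0 v : (forall i, eigen_coord v i = 0) -> v = 0.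
Proof.
move=> v0; have SST : S *m S^T = 1%:M by apply: mulmx1C.
rewrite -[v]mul1mx -SST -mulmxA.
suff -> : S^T *m v = 0 by rewrite mulmx0.
by apply/matrixP => i j; rewrite [j]ord1 [RHS]mxE; apply: v0.
Qed.

End EigenCoordinates.

(** * Optimality of preconditioned conjugate gradients *)

Section PcgTheory.
Variables (R : rcfType) (n : nat) (S A F : 'M[R]_n) (lam f : 'rV[R]_n).
Variables (b x0 : 'cV[R]_n).
Hypothesis S_orth : S^T *m S = 1%:M.
Hypothesis A_diag : A = S *m diag_mx lam *m S^T.
Hypothesis F_diag : F = S *m diag_mx f *m S^T.
Hypothesis lam_gt0 : forall i, 0 < lam 0 i.
Hypothesis f_gt0 : forall i, 0 < f 0 i.

Notation coord := (eigen_coord S).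
Let mu i := f 0 i * lam 0 i.
Let res0 i := coord (b - A *m x0) i.
Let dot := node_dot (fun i => f 0 i * res0 i ^+ 2) mu.

(** The direction carries one more factor f_i than the residual, since it lies
    in the preconditioned Krylov space. *)
Definition pcg_state_polys m (s : pcg_state R n) (r p : {poly R}) :=
  [/\ pcg_r s = b - A *m pcg_x s,
      forall i, coord (pcg_r s) i = r.[mu i] * res0 i,
      forall i, coord (pcg_p s) i = f 0 i * (p.[mu i] * res0 i),
      pcg_rho s = dot r r
    & pcg_polys m r p /\ conjugate_pair (fun i => f 0 i * res0 i ^+ 2) mu m r p].

Notation state l := (iter l (pcg_step A F) (pcg_init A F b x0)).

Lemma coordA v i : coord (A *m v) i = lam 0 i * coord v i.
Proof. by rewrite A_diag eigen_coord_diag. Qed.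

Lemma coordF v i : coord (F *m v) i = f 0 i * coord v i.
Proof. by rewrite F_diag eigen_coord_diag. Qed.

Lemma pcg_init_polys : pcg_state_polys 0 (pcg_init A F b x0) 1 1.
Proof.
split=> //=.
- by move=> i; rewrite hornerE mul1r.
- by move=> i; rewrite coordF !hornerE /= mulr1.
- rewrite (vdot_eigen_coord S_orth); apply: eq_bigr => i _.
  by rewrite coordF -/(res0 i) !hornerE /=; ring.
split; first exact: PcgPolys0.
by split=> h; rewrite leqn0 size_poly_eq0 => /eqP->; rewrite linear0.
Qed.

(** As the residual is nonzero, the form is positive on r; it is then positive
    on the direction too: otherwise p would vanish at every node of positive
    weight, against <r, p> = <r, r>.  So the step length is positive. *)
Lemma pcg_step_polys m s r p : pcg_state_polys m s r p -> pcg_r s != 0 ->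
  exists r' p', pcg_state_polys m.+1 (pcg_step A F s) r' p'.
Proof.
case: s => x rs ps rho [/= Drs Crs Cps Drho [pcg_rp conj_rp]] rs_neq0.
have weight_ge0 i : 0 <= f 0 i * res0 i ^+ 2.
  by rewrite pmulr_rge0 ?sqr_ge0.
have mu_gt0 i : 0 < mu i by rewrite mulr_gt0.
have dot_ge0 q : 0 <= dot q q.
  by apply: sumr_ge0 => i _; rewrite mulr_ge0 // -expr2 sqr_ge0.
have rr_gt0: 0 < dot r r.
  rewrite lt_def dot_ge0 andbT; apply: contra rs_neq0 => /eqP rr0.
  apply/eqP/(eigen_coord_eq0 S_orth) => i; rewrite Crs.
  have term_ge0 j : true -> 0 <= f 0 j * res0 j ^+ 2 * (r.[mu j] * r.[mu j]).
    by move=> _; rewrite mulr_ge0 // -expr2 sqr_ge0.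
  have /(_ i isT)/eqP := psumr_eq0P term_ge0 rr0.
  rewrite -expr2 -mulrA -exprMn mulf_eq0 gt_eqF //= expf_eq0 /= mulrC.
  by move/eqP.
have rpE: dot r p = dot r r.
  have [_ _ sz_pr _ _] := pcg_polys_size pcg_rp.
  by rewrite -{1}(subrK r p) /dot linearD /= (proj1 conj_rp) ?add0r.
have term_ge0 j : true ->
    0 <= f 0 j * res0 j ^+ 2 * (('X * p).[mu j] * p.[mu j]).
  move=> _; rewrite mulr_ge0 // !hornerE /= -mulrA -expr2.
  by rewrite pmulr_rge0 ?sqr_ge0.
have pp_gt0: 0 < dot ('X * p) p.
  rewrite lt_def sumr_ge0 ?andbT; last by move=> i _; apply: term_ge0.
  apply/negP => /eqP pp0; move: rr_gt0; rewrite -rpE.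
  rewrite /dot /node_dot big1 ?ltxx // => i _.
  have /(_ i isT) := psumr_eq0P term_ge0 pp0.
  move/eqP; rewrite !hornerE !mulf_eq0 !(gt_eqF (f_gt0 i)) (gt_eqF (lam_gt0 i)) !orbb /=.
  rewrite !orbF.
  by case/orP=> [/orP[]|] /eqP->; rewrite !(mulr0, mul0r).
have qpE: vdot (A *m ps) ps = dot ('X * p) p.
  rewrite (vdot_eigen_coord S_orth); apply: eq_bigr => i _.
  by rewrite coordA Cps !hornerE /= /mu; ring.
set alpha := dot r r / dot ('X * p) p.
have alpha_gt0: 0 < alpha by rewrite divr_gt0.
pose r' := r - alpha *: ('X * p).
pose beta := dot r' r' / dot r r.
have beta_ge0: 0 <= beta by rewrite divr_ge0 // ltW.
exists r', (r' + beta *: p).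
rewrite /pcg_state_polys /= (negPf rs_neq0) /= qpE Drho -/alpha.
set rs' := rs - _.
have Crs' i : coord rs' i = r'.[mu i] * res0 i.
  rewrite /rs' eigen_coordB eigen_coordZ coordA Crs Cps /r' !hornerE /= /mu; ring.
have rho'E : vdot rs' (F *m rs') = dot r' r'.
  rewrite (vdot_eigen_coord S_orth); apply: eq_bigr => i _.
  by rewrite coordF Crs'; ring.
rewrite rho'E -/beta; split=> //.
- by rewrite /rs' Drs mulmxDr -scalemxAr opprD addrA.
- by move=> i; rewrite eigen_coordD eigen_coordZ coordF Crs' Cps !hornerE /=; ring.
split; first exact: PcgPolysS.
by apply: conjugate_pair_step => //; apply: lt0r_neq0.
Qed.

(** Once the residual vanishes the state is frozen, so m may stay below l. *)
Lemma pcg_iter_polys l : exists m r p,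
  [/\ (m <= l)%N, pcg_state_polys m (state l) r p
    & pcg_r (state l) = 0 \/ m = l].
Proof.
elim: l => [|l [m [r [p [le_ml st_rp res_l]]]]].
  by exists 0%N, 1, 1; split; [| apply: pcg_init_polys | right].
have [r0 | r_neq0] := eqVneq (pcg_r (state l)) 0.
  exists m, r, p; have -> : state l.+1 = state l.
    by rewrite iterS; case: (state l) r0 => x rs ps rho /= ->; rewrite eqxx.
  by split; [apply: leqW | | left].
case: res_l => [r0 | Dm]; first by rewrite r0 eqxx in r_neq0.
have [r' [p' st_rp']] := pcg_step_polys st_rp r_neq0.
by exists m.+1, r', p'; split=> //; right; rewrite Dm.
Qed.

Let err0 i := coord (invmx A *m b - x0) i.

Lemma solution_eq : A *m (invmx A *m b) = b.
Proof.
have [ST_unit S_unit] := mulmx1_unit S_orth.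
rewrite mulmxA mulmxV ?mul1mx // A_diag !unitmx_mul S_unit ST_unit andbT /=.
rewrite unitmxE det_diag unitfE; apply/prodf_neq0 => i _.
exact: lt0r_neq0.
Qed.

Lemma coord_error x i :
  lam 0 i * coord (invmx A *m b - x) i = coord (b - A *m x) i.
Proof. by rewrite -coordA mulmxBr solution_eq. Qed.

Lemma pcg_error_poly l : exists m r p, [/\ (m <= l)%N, pcg_polys m r p
  & forall i, coord (invmx A *m b - pcg A F b x0 l) i = r.[mu i] * err0 i].
Proof.
have [m [r [p [le_ml [Dr Cr _ _ [pcg_rp _]] _]]]] := pcg_iter_polys l.
exists m, r, p; split=> // i; apply: (mulfI (lt0r_neq0 (lam_gt0 i))).
by rewrite coord_error -Dr Cr /res0 -coord_error mulrCA.
Qed.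

Lemma energy_eigen_coord v : vdot v (A *m v) = \sum_i lam 0 i * coord v i ^+ 2.
Proof.
rewrite (vdot_eigen_coord S_orth); apply: eq_bigr => i _.
by rewrite coordA; ring.
Qed.

(** If the method has not stopped before step l, a competitor is q = r + 'X * h
    with h of degree below l; by orthogonality of r to h its energy exceeds
    that of r by the energy of the correction. *)
Lemma pcg_optimal l (q : {poly R}) (e := invmx A *m b - pcg A F b x0 l) :
    (size q <= l.+1)%N -> q.[0] = 1 ->
  vdot e (A *m e) <= \sum_i lam 0 i * (q.[mu i] * err0 i) ^+ 2.
Proof.
move=> sz_q q0; rewrite energy_eigen_coord.
have [m [r [p [_ [Dr Cr _ _ [pcg_rp [orth_r _]]] stop]]]] := pcg_iter_polys l.
have Ce i : lam 0 i * coord e i = r.[mu i] * res0 i by rewrite coord_error -Dr Cr.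
have res0E i : res0 i = lam 0 i * err0 i by rewrite coord_error.
case: stop => [r_l0 | Dm].
  apply: ler_sum => i _; have := Ce i.
  rewrite -Cr r_l0 [RHS]/eigen_coord mulmx0 mxE => /eqP.
  rewrite mulf_eq0 gt_eqF //= => /eqP->.
  by rewrite expr0n mulr0 mulr_ge0 ?sqr_ge0 // ltW.
have [sz_r _ _ r0 _] := pcg_polys_size pcg_rp.
have root_qr: root (q - r) 0 by rewrite /root !hornerE q0 r0 subrr.
have [h Dqr] := factor_theorem _ _ root_qr.
have sz_h: (size h <= m)%N.
  have [-> | h_neq0] := eqVneq h 0; first by rewrite size_poly0.
  have: (size (q - r)%R <= m.+1)%N.
    by rewrite (leq_trans (size_polyD _ _)) // size_polyN geq_max sz_r leqnn Dm sz_q.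
  by rewrite Dqr size_Mmonic ?monicXsubC // size_XsubC addn2.
have Dq i : q.[mu i] = r.[mu i] + mu i * h.[mu i].
  have -> : q = h * ('X - 0%:P) + r by rewrite -Dqr subrK.
  by rewrite !hornerE /= subr0; ring.
have Ei i : coord e i = r.[mu i] * err0 i.
  by apply: (mulfI (lt0r_neq0 (lam_gt0 i))); rewrite Ce res0E; ring.
have -> : \sum_i lam 0 i * (q.[mu i] * err0 i) ^+ 2 =
    \sum_i lam 0 i * coord e i ^+ 2 + 2 * dot r h
    + \sum_i lam 0 i * (mu i * h.[mu i] * err0 i) ^+ 2.
  rewrite mulr_sumr -!big_split; apply: eq_bigr => i _ /=.
  by rewrite Ei Dq res0E /mu; ring.
rewrite /dot orth_r // mulr0 addr0 lerDl sumr_ge0 // => i _.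
by rewrite mulr_ge0 ?sqr_ge0 // ltW.
Qed.

End PcgTheory.

(** * Comparison of the two methods *)

Lemma scaled_spectral_prec_diag (R : rcfType) (n : nat) (S : 'M[R]_n)
    (lam : 'rV[R]_n) k theta : S^T *m S = 1%:M ->
  scaled_spectral_prec S lam k theta =
  S *m diag_mx (\row_i (if (i < k)%N then theta / lam 0 i else 1)) *m S^T.
Proof.
move=> S_orth; have SST : S *m S^T = 1%:M by apply: mulmx1C.
apply/matrixP => a c; rewrite /scaled_spectral_prec mul_mx_diag -SST !mxE summxE.
rewrite [X in _ + X]big_mkcond -big_split; apply: eq_bigr => i _ /=.
rewrite !mxE; case: ifP => _; last by rewrite addr0 mulr1.
by rewrite big_ord1 !mxE; ring.
Qed.

Theorem theorem4p4 (R : rcfType) (n : nat)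
    (A S : 'M[R]_n) (lam : 'rV[R]_n) (b x0 : 'cV[R]_n)
    (k : nat) (hk0 : (0 < k)%N) (hkn : (k < n)%N) (theta : R)
    (hA : spd A) (hS : spectral_decomposition A S lam)
    (htheta : lam 0 (Ordinal hkn) <= theta <= lam 0 (Ordinal (ltn_pred_trans hkn)))
    (l : nat) (hl : (1 <= l <= n)%N) :
  energy_norm A
    (invmx A *m b - pcg A (scaled_spectral_prec S lam k theta) b x0 l)
  <= energy_norm A (invmx A *m b - cg A b x0 l).
Proof.
case: hS => S_orth A_diag lam_mono lam_gt0.
case/andP: htheta => theta_ge theta_le.
have theta_gt0: 0 < theta by apply: lt_le_trans theta_ge.
apply: ler_wsqrtr; set f := \row_i (if (i < k)%N then theta / lam 0 i else 1).
have F_diag := scaled_spectral_prec_diag lam k theta S_orth.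
have f_gt0 i : 0 < f 0 i by rewrite mxE; case: ifP => // _; rewrite divr_gt0.
have I_diag : 1%:M = S *m diag_mx (const_mx 1) *m S^T.
  by rewrite diag_const_mx mulmx1 (mulmx1C S_orth).
have one_gt0 (i : 'I_n) : 0 < (const_mx 1 : 'rV[R]_n) 0 i by rewrite mxE.
have [m [r [p [le_ml pcg_rp Ecg]]]] :=
  pcg_error_poly b x0 S_orth A_diag I_diag lam_gt0 one_gt0 l.
have [q [sz_q q0 q_theta q_le]] := pcg_polys_competitor theta_gt0 pcg_rp.
apply: le_trans
  (pcg_optimal b x0 S_orth A_diag F_diag lam_gt0 f_gt0 (leq_trans sz_q _) q0) _.
  by [].
rewrite (energy_eigen_coord S_orth A_diag); apply: ler_sum => i _.
rewrite ler_pM2l // /cg Ecg !exprMn; apply: ler_wpM2r; first exact: sqr_ge0.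
rewrite -[leLHS]real_normK ?num_real // -[leRHS]real_normK ?num_real //.
rewrite ler_pXn2r ?nnegrE // !mxE mul1r; case: ifP => lt_ik.
  rewrite divfK ?lt0r_neq0 //; apply: q_theta; apply: le_trans theta_le _.
  by apply: lam_mono => /=; rewrite -ltnS prednK.
rewrite mul1r; apply: q_le; rewrite lam_gt0; apply: le_trans theta_ge.
by apply: lam_mono; rewrite /= leqNgt lt_ik.
Qed.
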